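(* Let $P$ and $U$ be monic elements of $\mathcal{G}$ with associated polynomial sequences $\{p_k(t)\}_{k\ge 0}$ and $\{u_k(t)\}_{k\ge 0}$ respectively. Define $H = P X P^{-1}$ and $K = U X U^{-1}$. Then $$p_n(t)\,p_m(t) = \sum_{k=0}^{n+m} e(n,m,k)\, u_k(t), \qquad n,m\in\mathbb{N},$$ where $$e(n,m,k) = \sum_{j=0}^{n+m} p_n(H)_{m,j}\; p_j(K)_{0,k}, \qquad n,m,k\in\mathbb{N}.$$
   Context: $\mathbb{N}$ denotes the non-negative integers. All matrices are infinite, with complex entries and rows and columns indexed by $\mathbb{N}$. $\mathcal{L}$ is the set of matrices $A=[a_{j,k}]$ for which there is an integer $m$ such that $a_{j,k}=0$ whenever $j-k<m$ (lower generalized Hessenberg matrices); it is closed under addition, scalar multiplication and matrix multiplication (all sums in products are finite). $\mathcal{G}$ is the group, under matrix multiplication, of the lower triangular matrices ($a_{j,k}=0$ for $j<k$) with $a_{k,k}\neq 0$ for all $k\ge 0$; its unit is the identity matrix $I$. An element of $\mathcal{G}$ is monic if all its entries on the main diagonal are equal to $1$. $X$ is the matrix with $X_{j,j+1}=1$ for $j\ge 0$ and all other entries zero. The polynomial sequence associated with $P\in\mathcal{G}$ is $p_k(t)=\sum_{j=0}^{k} P_{k,j}\,t^j$, $k\ge 0$ (the $k$-th row of the matrix contains the coefficients of the $k$-th polynomial); likewise $u_k(t)=\sum_{j=0}^{k}U_{k,j}t^j$ for $U$. For a polynomial $w(t)=\sum_i w_i t^i$ and a matrix $M\in\mathcal{L}$,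 $w(M)=\sum_i w_i M^i$ with $M^0=I$. *)

(* Defs.v *)
From HB Require Import structures.
From mathcomp Require Import all_boot all_order all_algebra.
From mathcomp Require Import mathcomp_extra boolp classical_sets functions.
From mathcomp Require Import fsbigop reals.
From mathcomp Require Export complex.
From mathcomp Require Import zify.

Set Implicit Arguments.
Unset Strict Implicit.
Unset Printing Implicit Defensive.

Import Order.TTheory GRing.Theory Num.Theory.

Local Open Scope classical_set_scope.
Local Open Scope ring_scope.

Section InfiniteMatrices.
Variable F : fieldType.

Implicit Types A B C : nat -> nat -> F.

Definition is_lhessenberg A : Prop :=
  exists m : int, forall j k : nat, j%:Z - k%:Z < m -> A j k = 0.

(* The sum ranges over the finite support of its summand; it is 0 by convention
   if this support is infinite, which does not happen for Hessenberg [A]. *)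
Definition imx_mul A B : nat -> nat -> F :=
  fun j k => \sum_(i \in [set: nat]) A j i * B i k.

Definition imx_one : nat -> nat -> F := fun j k => (j == k)%:R.

Definition imx_shift : nat -> nat -> F := fun j k => (k == j.+1)%:R.

Lemma imx_mulE N A B j k : (forall i, (N <= i)%N -> A j i = 0) ->
  imx_mul A B j k = \sum_(i < N) A j i * B i k.
Proof.
move=> A0; rewrite (fsbig_ord _ _ (fun i => A j i * B i k)).
apply/esym/fsbig_widen => // i [_ /= /negP]; rewrite -leqNgt => /A0 ->.
exact: mul0r.
Qed.

Lemma lhessenberg_row A j : is_lhessenberg A ->
  exists N, forall i, (N <= i)%N -> A j i = 0.
Proof.
move=> [m Am]; exists (`|j%:Z - m|.+1)%N => i Ni; apply: Am; lia.
Qed.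

Lemma lhessenberg0 : is_lhessenberg (0 : nat -> nat -> F).
Proof. by exists 0. Qed.

Lemma lhessenberg1 : is_lhessenberg imx_one.
Proof. by exists 0 => j k jk; rewrite /imx_one; case: eqP => // ?; lia. Qed.

Lemma lhessenberg_shift : is_lhessenberg imx_shift.
Proof. by exists (-1) => j k jk; rewrite /imx_shift; case: eqP => // ?; lia. Qed.

Lemma lhessenbergB A B :
  is_lhessenberg A -> is_lhessenberg B -> is_lhessenberg (A - B).
Proof.
move=> [m Am] [n Bn]; exists (Order.min m n) => j k jk.
rewrite -[LHS]/(A j k - B j k) Am ?Bn ?subr0 //; lia.
Qed.

Lemma lhessenbergZ a A :
  is_lhessenberg A -> is_lhessenberg (fun j k => a * A j k).
Proof. by move=> [m Am]; exists m => j k jk; rewrite Am ?mulr0. Qed.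

Lemma lhessenbergM A B :
  is_lhessenberg A -> is_lhessenberg B -> is_lhessenberg (imx_mul A B).
Proof.
move=> [m Am] [n Bn]; exists (m + n) => j k jk; rewrite /imx_mul fsbig1 // => i _.
have [ji|ji] := ltP (j%:Z - i%:Z) m; first by rewrite Am ?mul0r.
by rewrite Bn ?mulr0 //; lia.
Qed.

Definition lhess_pred : {pred (nat -> nat -> F)} :=
  fun A => `[< is_lhessenberg A >].

Record lhessenberg := LHessenberg {
  lhess_val :> nat -> nat -> F;
  lhess_valP : lhess_val \in lhess_pred }.

HB.instance Definition _ := [isSub for lhess_val].
HB.instance Definition _ := [Choice of lhessenberg by <:].

Fact lhess_zmod_closed : zmod_closed lhess_pred.
Proof.
split; first exact/asboolP/lhessenberg0.
by move=> A B /asboolP LA /asboolP LB; exact/asboolP/lhessenbergB.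
Qed.

HB.instance Definition _ :=
  GRing.isZmodClosed.Build _ lhess_pred lhess_zmod_closed.
HB.instance Definition _ :=
  [SubChoice_isSubZmodule of lhessenberg by <:].

Implicit Types P Q S : lhessenberg.

Lemma lhessP P : is_lhessenberg P.
Proof. exact/asboolP/lhess_valP. Qed.

Lemma lhess_eqP P Q : (forall j k, P j k = Q j k) -> P = Q.
Proof.
by move=> PQ; apply/val_inj/funext => j; apply/funext => k; exact: PQ.
Qed.

Definition lhess_mk A (LA : is_lhessenberg A) : lhessenberg :=
  LHessenberg (asboolT LA).

Definition lhess_one := lhess_mk lhessenberg1.
Definition lhess_mul P Q := lhess_mk (lhessenbergM (lhessP P) (lhessP Q)).

Fact lhess_mulE N P Q j k : (forall i, (N <= i)%N -> P j i = 0) ->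
  lhess_mul P Q j k = \sum_(i < N) P j i * Q i k.
Proof. exact: imx_mulE. Qed.

Fact lhess_addE P Q j k : (P + Q) j k = P j k + Q j k. Proof. by []. Qed.

Definition lhess_scale a P := lhess_mk (lhessenbergZ a (lhessP P)).

Fact lhess_scaleA a b P : lhess_scale a (lhess_scale b P) = lhess_scale (a * b) P.
Proof. by apply: lhess_eqP => j k; rewrite /= mulrA. Qed.

Fact lhess_scale1 : left_id 1 lhess_scale.
Proof. by move=> P; apply: lhess_eqP => j k; rewrite /= mul1r. Qed.

Fact lhess_scaleDr : right_distributive lhess_scale +%R.
Proof. by move=> a P Q; apply: lhess_eqP => j k; exact: mulrDr. Qed.

Fact lhess_scaleDl P : {morph lhess_scale^~ P : a b / a + b}.
Proof. by move=> a b; apply: lhess_eqP => j k; exact: mulrDl. Qed.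

HB.instance Definition _ := GRing.Zmodule_isLmodule.Build F lhessenberg
  lhess_scaleA lhess_scale1 lhess_scaleDr lhess_scaleDl.

Fact lhess_scaleE a P j k : (a *: P) j k = a * P j k. Proof. by []. Qed.

Fact lhess_mulA : associative lhess_mul.
Proof.
move=> P Q S; apply: lhess_eqP => j k.
have [N PN] := lhessenberg_row j (lhessP P).
have [M QM] : exists M, forall l i, (l < N)%N -> (M <= i)%N -> Q l i = 0.
  elim: N {PN} => [|N [M QM]]; first by exists 0%N.
  have [M' QM'] := lhessenberg_row N (lhessP Q).
  exists (maxn M M') => l i; rewrite ltnS leq_eqVlt geq_max => /orP[/eqP ->|lN].
    by move=> /andP[_]; exact: QM'.
  by move=> /andP[Mi _]; exact: QM.
rewrite (lhess_mulE _ _ PN) [RHS](@lhess_mulE M); last first.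
  move=> i Mi; rewrite (lhess_mulE _ _ PN) big1 // => l _.
  by rewrite QM ?mulr0.
under eq_bigr => l _.
  rewrite (@lhess_mulE M); last by move=> i Mi; exact: QM.
  rewrite mulr_sumr; over.
rewrite exchange_big; apply: eq_bigr => i _.
rewrite (lhess_mulE _ _ PN) mulr_suml.
by apply: eq_bigr => l _; rewrite mulrA.
Qed.

Fact lhess_mul1 : left_id lhess_one lhess_mul.
Proof.
move=> P; apply: lhess_eqP => j k.
rewrite (@lhess_mulE j.+1) => [|i ji]; last first.
  by rewrite /= /imx_one; case: eqP => // ?; lia.
rewrite big_ord_recr big1 /= => [|i _]; rewrite /imx_one.
  by rewrite eqxx mul1r add0r.
by rewrite gtn_eqF ?mul0r.
Qed.

Fact lhess_mulr1 : right_id lhess_one lhess_mul.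
Proof.
move=> P; apply: lhess_eqP => j k.
have [N PN] := lhessenberg_row j (lhessP P).
rewrite (lhess_mulE _ _ PN) /= /imx_one; have [kN|Nk] := ltnP k N.
  rewrite (bigD1 (Ordinal kN)) //= eqxx mulr1 big1 ?addr0 // => i.
  by rewrite -val_eqE /= => /negPf ->; rewrite mulr0.
rewrite big1 ?PN // => i _; rewrite ltn_eqF ?mulr0 //.
exact: leq_trans (ltn_ord i) Nk.
Qed.

Fact lhess_mulDl : left_distributive lhess_mul +%R.
Proof.
move=> P Q S; apply: lhess_eqP => j k.
have [N PN] := lhessenberg_row j (lhessP P).
have [M QM] := lhessenberg_row j (lhessP Q).
have PNM i : (maxn N M <= i)%N -> P j i = 0.
  by rewrite geq_max => /andP[/PN].
have QNM i : (maxn N M <= i)%N -> Q j i = 0.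
  by rewrite geq_max => /andP[_ /QM].
rewrite lhess_addE !(@lhess_mulE (maxn N M)) //; last first.
  by move=> i NMi; rewrite lhess_addE PNM ?QNM ?addr0.
by rewrite -big_split; apply: eq_bigr => i _; rewrite lhess_addE mulrDl.
Qed.

Fact lhess_mulDr : right_distributive lhess_mul +%R.
Proof.
move=> P Q S; apply: lhess_eqP => j k.
have [N PN] := lhessenberg_row j (lhessP P).
rewrite lhess_addE !(lhess_mulE _ _ PN) -big_split.
by apply: eq_bigr => i _; rewrite lhess_addE mulrDr.
Qed.

Fact lhess_one_neq0 : lhess_one != 0.
Proof.
apply/eqP => /(congr1 (fun P : lhessenberg => P 0%N 0%N))/eqP.
by rewrite /= /imx_one oner_eq0.
Qed.

HB.instance Definition _ := GRing.Zmodule_isNzRing.Build lhessenberg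
  lhess_mulA lhess_mul1 lhess_mulr1 lhess_mulDl lhess_mulDr lhess_one_neq0.

Lemma lhessM N P Q j k : (forall i, (N <= i)%N -> P j i = 0) ->
  (P * Q) j k = \sum_(i < N) P j i * Q i k.
Proof. exact: lhess_mulE. Qed.

Fact lhess_scaleAl a P Q : a *: (P * Q) = (a *: P) * Q.
Proof.
apply: lhess_eqP => j k; have [N PN] := lhessenberg_row j (lhessP P).
rewrite lhess_scaleE !(@lhessM N) //; last first.
  by move=> i Ni; rewrite lhess_scaleE PN ?mulr0.
by rewrite mulr_sumr; apply: eq_bigr => i _; rewrite mulrA.
Qed.

HB.instance Definition _ :=
  GRing.Lmodule_isLalgebra.Build F lhessenberg lhess_scaleAl.

Fact lhess_scaleAr a P Q : a *: (P * Q) = P * (a *: Q).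
Proof.
apply: lhess_eqP => j k; have [N PN] := lhessenberg_row j (lhessP P).
rewrite lhess_scaleE !(lhessM _ _ PN) mulr_sumr.
by apply: eq_bigr => i _; rewrite lhess_scaleE mulrCA.
Qed.

HB.instance Definition _ :=
  GRing.Lalgebra_isAlgebra.Build F lhessenberg lhess_scaleAr.

Definition lhess_unit : pred lhessenberg :=
  fun P => `[< exists Q, Q * P = 1 /\ P * Q = 1 >].

Definition lhess_inv P : lhessenberg :=
  if pselect (exists Q, Q * P = 1 /\ P * Q = 1) is left PV
  then sval (cid PV) else P.

Fact lhess_mulV : {in lhess_unit, left_inverse 1 lhess_inv *%R}.
Proof.
move=> P /asboolP PV; rewrite /lhess_inv; case: pselect => // PV'.
by case: cid => Q [].
Qed.

Fact lhess_divV : {in lhess_unit, right_inverse 1 lhess_inv *%R}.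
Proof.
move=> P /asboolP PV; rewrite /lhess_inv; case: pselect => // PV'.
by case: cid => Q [].
Qed.

Fact lhess_unitP P Q : Q * P = 1 /\ P * Q = 1 -> lhess_unit P.
Proof. by move=> PQ; apply/asboolP; exists Q. Qed.

Fact lhess_inv_out : {in [predC lhess_unit], lhess_inv =1 id}.
Proof.
by move=> P /asboolP PV; rewrite /lhess_inv; case: pselect.
Qed.

HB.instance Definition _ := GRing.NzRing_hasMulInverse.Build lhessenberg
  lhess_mulV lhess_divV lhess_unitP lhess_inv_out.

Definition shift_mx : lhessenberg := lhess_mk lhessenberg_shift.

(* Membership in the group G: its elements are units of the algebra
   [lhessenberg], with inverses in G ([ltri_unit], [ltri_inv] below), so [P^-1]
   is the inverse of [P] in G. *)
Definition is_ltri_unit P : Prop :=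
  (forall j k, (j < k)%N -> P j k = 0) /\ (forall k, P k k != 0).

Definition is_monic P : Prop := is_ltri_unit P /\ forall k, P k k = 1.

Definition assoc_poly P (k : nat) : {poly F} := \poly_(j < k.+1) P k j.

Lemma ltriM P Q j k : (forall j k, (j < k)%N -> P j k = 0) ->
  (P * Q) j k = \sum_(i < j.+1) P j i * Q i k.
Proof. by move=> P0; apply: lhessM => i; exact: P0. Qed.

Lemma lhess1E j k : (1 : lhessenberg) j k = (j == k)%:R.
Proof. by []. Qed.

(* Right inverse by forward substitution: the list of the first [n] entries of
   its column [k]. *)
Fixpoint ltri_col P (k n : nat) : seq F :=
  if n is n'.+1 then
    let s := ltri_col P k n' in
    rcons s (((n' == k)%:R - \sum_(i < n') P n' i * nth 0 s i) / P n' n')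
  else [::].

Fact ltri_right_inv P : is_ltri_unit P ->
  exists Q, is_ltri_unit Q /\ P * Q = 1.
Proof.
move=> [P0 Pn0].
pose B j k := nth 0 (ltri_col P k j.+1) j.
have sz k n : size (ltri_col P k n) = n.
  by elim: n => //= n IH; rewrite size_rcons IH.
have nthB k n j : (j < n)%N -> nth 0 (ltri_col P k n) j = B j k.
  elim: n => // n IH; rewrite ltnS leq_eqVlt => /orP[/eqP -> //|jn].
  by rewrite /= nth_rcons sz jn IH.
have BE j k : B j k = ((j == k)%:R - \sum_(i < j) P j i * B i k) / P j j.
  rewrite {1}/B /= nth_rcons sz ltnn eqxx; congr ((_ - _) / _).
  by apply: eq_bigr => i _; rewrite nthB.
have B0 j k : (j < k)%N -> B j k = 0.
  elim/ltn_ind: j => j IH jk; rewrite BE ltn_eqF // big1 ?subrr ?mul0r // => i _.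
  by rewrite IH ?mulr0 //; exact: ltn_trans (ltn_ord i) jk.
have LB : is_lhessenberg B by exists 0 => j k jk; apply: B0; lia.
exists (lhess_mk LB); split; first split => //= k.
  rewrite BE eqxx big1 ?subr0 => [|i _]; last by rewrite B0 ?mulr0.
  by rewrite mulf_neq0 ?oner_eq0 ?invr_eq0.
apply: lhess_eqP => j k; rewrite ltriM // big_ord_recr /= BE.
by rewrite mulrC divfK // addrC subrK.
Qed.

Fact ltri_two_sided P : is_ltri_unit P ->
  exists Q, [/\ is_ltri_unit Q, Q * P = 1 & P * Q = 1].
Proof.
move=> /ltri_right_inv[Q [GQ PQ]]; exists Q; split=> //.
have [S [_ QS]] := ltri_right_inv GQ.
by have -> : P = S by rewrite -[P]mulr1 -QS mulrA PQ mul1r.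
Qed.

Lemma ltri_unit P : is_ltri_unit P -> P \is a GRing.unit.
Proof. by move=> /ltri_two_sided[Q [_ QP PQ]]; apply/unitrP; exists Q. Qed.

Lemma ltri_inv P : is_ltri_unit P -> is_ltri_unit P^-1.
Proof.
move=> GP; have [Q [GQ QP _]] := ltri_two_sided GP.
by rewrite -[P^-1]mul1r -QP mulrK // ltri_unit.
Qed.

End InfiniteMatrices.

(* Main.v *)
(* For a polynomial [f], row [m] of [P * f(X)] lists the coefficients of
   [f * p_m], and [f(H) * P = P * f(X)]; hence row [m] of [f(H)] lists the
   coordinates of [f * p_m] in the basis [p_0, p_1, ...].  Expand [p_n * p_m] in
   this way in the basis of the [p_j], then [p_j = p_j * u_0] in the basis of
   the [u_k]. *)
Require Import Defs.
From mathcomp Require Import all_boot all_order all_algebra reals.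

Import GRing.Theory.
Local Open Scope ring_scope.

(** Conjugation by a unit is an algebra automorphism, so it commutes with evaluating polynomials. *)
Lemma horner_alg_conj (F : fieldType) (A : unitAlgType F) (a x : A)
    (f : {poly F}) : a \is a GRing.unit ->
  horner_alg (a * x * a^-1) f = a * horner_alg x f * a^-1.
Proof.
move=> Ua; elim/poly_ind: f => [|f c IH]; first by rewrite !rmorph0 mulr0 mul0r.
rewrite !rmorphD !rmorphM /= IH !horner_algX !horner_algC mulrDr mulrDl.
by rewrite -scalerAr mulr1 -scalerAl mulrV // !mulrA mulrVK.
Qed.

Lemma lhess_shiftM (F : fieldType) (A : lhessenberg F) i k :
  (shift_mx F * A) i k = A i.+1 k.
Proof.
rewrite (@lhessM _ i.+2) => [|j ij]; last by rewrite /= /imx_shift gtn_eqF.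
rewrite big_ord_recr big1 /= => [|j _]; rewrite /imx_shift.
  by rewrite eqxx mul1r add0r.
by rewrite ltn_eqF ?mul0r.
Qed.

Lemma horner_alg_shiftE (F : fieldType) (f : {poly F}) i k :
  horner_alg (shift_mx F) f i k = (f * 'X^i)`_k.
Proof.
elim/poly_ind: f i k => [|f c IH] i k; first by rewrite rmorph0 mul0r coef0.
(* The shift is moved to the left, where multiplying by it only moves rows up by one. *)
have -> : horner_alg (shift_mx F) (f * 'X + c%:P) =
    shift_mx F * horner_alg (shift_mx F) f + c%:A.
  by rewrite commr_polyX rmorphD rmorphM /= horner_algX horner_algC.
rewrite lhess_addE lhess_shiftM IH lhess_scaleE lhess1E.
by rewrite mulrDl -mulrA -exprS coefD coefCM coefXn eq_sym.
Qed.

(** Row [i] of [f(X)] lists the coefficients of [f * 'X^i]; row [m] of [P] combines these rows with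
    the coefficients of [p_m]. *)
Lemma ltri_horner_alg_shiftE (F : fieldType) (P : lhessenberg F)
    (f : {poly F}) m k : (forall j k, (j < k)%N -> P j k = 0) ->
  (P * horner_alg (shift_mx F) f) m k = (f * assoc_poly P m)`_k.
Proof.
move=> P0; rewrite ltriM // /assoc_poly poly_def mulr_sumr coef_sum.
apply: eq_bigr => i _.
by rewrite horner_alg_shiftE -scalerAr coefZ.
Qed.

(** The bound [N] is left free so that expansions of polynomials of different degrees can share one
    range. *)
Lemma assoc_poly_expansion (F : fieldType) (P : lhessenberg F) (f : {poly F})
    m N : is_ltri_unit P -> (size (f * assoc_poly P m)%R <= N)%N ->
  f * assoc_poly P m =
  \sum_(j < N) horner_alg (P * shift_mx F * P^-1) f m j *: assoc_poly P j.
Proof.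
move=> GP sN; have [P0 _] := GP; have UP := ltri_unit GP.
have [Q0 _] := ltri_inv GP.
have rowS k : (N <= k)%N -> (P * horner_alg (shift_mx F) f) m k = 0.
  by move=> Nk; rewrite ltri_horner_alg_shiftE // nth_default // (leq_trans sN).
rewrite horner_alg_conj //; set B := P * _.
(* [P^-1] is lower triangular, so row [m] of [f(H)] ends where row [m] of [B] does. *)
have rowH j : (N <= j)%N -> (B * P^-1) m j = 0.
  move=> Nj; rewrite (lhessM _ _ rowS) big1 // => k _.
  by rewrite Q0 ?mulr0 //; exact: leq_trans (ltn_ord k) Nj.
(* Compare entries [(m, k)] in [P * f(X) = f(H) * P]. *)
apply/polyP => k; rewrite -ltri_horner_alg_shiftE // -/B -[B](mulrVK UP).
rewrite (lhessM _ _ rowH) coef_sum; apply: eq_bigr => j _.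
rewrite coefZ coef_poly mulrVK //; case: ltnP => // jk.
by rewrite P0.
Qed.

Lemma size_assoc_poly_leq (F : fieldType) (P : lhessenberg F) k :
  (size (assoc_poly P k) <= k.+1)%N.
Proof. exact: size_poly. Qed.

Lemma assoc_poly0 (F : fieldType) (P : lhessenberg F) :
  is_monic P -> assoc_poly P 0 = 1.
Proof.
by case=> _ P1; rewrite /assoc_poly poly_def big_ord1 P1 scale1r expr0.
Qed.

Theorem theorem3p3 (R : realType) (P U : lhessenberg R[i])
    (hP : is_monic P) (hU : is_monic U) :
  let p := assoc_poly P in
  let u := assoc_poly U in
  let H := P * shift_mx R[i] * P^-1 in
  let K := U * shift_mx R[i] * U^-1 in
  let e (n m k : nat) : R[i] :=
    \sum_(0 <= j < (n + m).+1) horner_alg H (p n) m j * horner_alg K (p j) 0%N k in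
  forall n m : nat,
    p n * p m = \sum_(0 <= k < (n + m).+1) e n m k *: u k.
Proof.
move=> p u H K e n m.
have sz : (size (p n * p m)%R <= (n + m).+1)%N.
  apply: leq_trans (size_polyMleq _ _) _.
  have := leq_add (size_assoc_poly_leq _ P n) (size_assoc_poly_leq _ P m).
  by rewrite addSn addnS -/p; case: (_ + _)%N.
rewrite [LHS](assoc_poly_expansion _ _ _ _ _ hP.1 sz) big_mkord.
under [RHS]eq_bigr do rewrite /e big_mkord scaler_suml.
rewrite exchange_big; apply: eq_bigr => j _ /=.
(* As [j <= n + m], the range of [k] can be the same for every [j], which the exchange of sums
   requires. *)
have szj : (size (p j * u 0%N)%R <= (n + m).+1)%N.
  rewrite /u assoc_poly0 // mulr1.
  exact: leq_trans (size_assoc_poly_leq _ _ _) (ltn_ord j).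
have := assoc_poly_expansion _ _ _ _ _ hU.1 szj.
(* Since [u_0 = 1], row 0 of [p_j(K)] holds the coordinates of [p_j] itself. *)
rewrite {1}assoc_poly0 // mulr1 -/(p j) => {1}->; rewrite scaler_sumr.
by apply: eq_bigr => k _; rewrite scalerA.
Qed.
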